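(* Let $h\in\mathbb R$ and let $W:\mathrm{GL}_+(3,\mathbb R)\to[0,\infty)$ be a $C^2$ strain energy function which is objective, isotropic and homogeneous of degree $h$. Suppose that $$W(F(\lambda,\omega))=(\lambda_1\lambda_2^2)^{h/3}f(\lambda_1/\lambda_2)\qquad\text{for all }\lambda=(\lambda_1,\lambda_2)\in\mathbb R_+^2,\ \omega\in S^2,$$ where $f'(1)=0$ and $f''(u)\ge0$ for all $u\in\mathbb R_+$. Then $W$ is consistent with the Baker-Ericksen condition at the deformation gradients $F(\lambda,\omega)$; that is, $$\frac{t_1(\lambda)-t_2(\lambda)}{\lambda_1-\lambda_2}\ge0\qquad\text{for all }\lambda\in\mathbb R_+^2\text{ with }\lambda_1\ne\lambda_2,$$ where $t_1(\lambda)$ and $t_2(\lambda)$ are the eigenvalues of the Cauchy stress $T(F(\lambda,\omega))$ on the eigenspaces $\operatorname{span}\{\omega\}$ and $\operatorname{span}\{\omega\}^\perp$, respectively.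
   Context: $\mathbb R_+=(0,\infty)$; $S^2$ is the unit sphere in $\mathbb R^3$; $\mathrm{GL}_+(3,\mathbb R)$ is the set of real $3\times3$ matrices with positive determinant. $W$ is objective if $W(UF)=W(F)$, and isotropic if $W(FU)=W(F)$, for all $F\in\mathrm{GL}_+(3,\mathbb R)$, $U\in\mathrm{SO}(3,\mathbb R)$; homogeneous of degree $h$ if $W(\sigma F)=\sigma^hW(F)$ for $\sigma>0$. The Piola-Kirchhoff stress is $S(F)=\partial W/\partial F(F)$ and the Cauchy stress is $T(F)=(\det F)^{-1}S(F)F^\top$. For $\lambda\in\mathbb R_+^2$, $\omega\in S^2$: $F(\lambda,\omega)=\lambda_1P_1(\omega)+\lambda_2P_2(\omega)$ with $P_1(\omega)=\omega\otimes\omega$, $P_2(\omega)=I-\omega\otimes\omega$; its eigenvalues are $\lambda_1$ on $\operatorname{span}\{\omega\}$ and $\lambda_2$ on $\operatorname{span}\{\omega\}^\perp$. With $\mathcal L(\lambda)=W(F(\lambda,\omega))$ (independent of $\omega$), $T(F(\lambda,\omega))$ has these same eigenspaces, with eigenvalues $t_1(\lambda)=(\lambda_1\lambda_2^2)^{-1}\lambda_1\,\partial_{\lambda_1}\mathcal L(\lambda)$ and $t_2(\lambda)=(\lambda_1\lambda_2^2)^{-1}\tfrac12\lambda_2\,\partial_{\lambda_2}\mathcal L(\lambda)$. (The paper phrases ''at the deformation gradients $F(\lambda,\omega)$'' as ''along $\mathcal H$'', the curve of invariants of the shear strain tensors of the matrices $F(\lambda,\omega)$.) *)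

(* Defs.v *)
From HB Require Import structures.
From mathcomp Require Import all_boot all_order all_algebra.
From mathcomp Require Import all_classical all_reals all_analysis.

Set Implicit Arguments.
Unset Strict Implicit.
Unset Printing Implicit Defensive.

Import Order.TTheory GRing.Theory Num.Theory.
Import numFieldNormedType.Exports.

Local Open Scope classical_set_scope.
Local Open Scope ring_scope.

Definition GLplus3 (R : realType) : set 'M[R]_3 := [set F : 'M[R]_3 | 0 < \det F].

Definition SO3 (R : realType) : set 'M[R]_3 :=
  [set U : 'M[R]_3 | U *m U^T = 1%:M /\ \det U = 1].

Definition sphere2 (R : realType) : set 'cV[R]_3 :=
  [set w : 'cV[R]_3 | \sum_(i < 3) w i 0 ^+ 2 = 1].

(* A strain energy function on GL_+(3, R) is represented by a total function
   W : 'M[R]_3 -> R, of which only the values on GLplus3 are ever used; since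
   GLplus3 is open, this includes the derivatives at points of GLplus3. *)

(* The space of matrices being finite-dimensional, continuity of the
   differential F |-> 'd W F amounts to that of F |-> 'd W F H = 'D_H W F for
   every direction H. *)
Definition C1_on (R : realType) (D : set 'M[R]_3) (W : 'M[R]_3 -> R) : Prop :=
  forall F, D F -> differentiable W F /\
    forall H : 'M[R]_3, {for F, continuous (fun G => 'D_H W G)}.

Definition C2_on (R : realType) (D : set 'M[R]_3) (W : 'M[R]_3 -> R) : Prop :=
  C1_on D W /\ forall H : 'M[R]_3, C1_on D (fun G => 'D_H W G).

Definition objective (R : realType) (W : 'M[R]_3 -> R) : Prop :=
  forall F U : 'M[R]_3, GLplus3 F -> SO3 U -> W (U *m F) = W F.

Definition isotropic (R : realType) (W : 'M[R]_3 -> R) : Prop :=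
  forall F U : 'M[R]_3, GLplus3 F -> SO3 U -> W (F *m U) = W F.

Definition homogeneous_of_degree (R : realType) (h : R) (W : 'M[R]_3 -> R) :
    Prop :=
  forall (s : R) (F : 'M[R]_3), 0 < s -> GLplus3 F -> W (s *: F) = s `^ h * W F.

Definition piola_kirchhoff (R : realType) (W : 'M[R]_3 -> R) (F : 'M[R]_3) :
    'M[R]_3 :=
  \matrix_(i < 3, j < 3) 'D_(delta_mx i j) W F.

Definition cauchy_stress (R : realType) (W : 'M[R]_3 -> R) (F : 'M[R]_3) :
    'M[R]_3 :=
  (\det F)^-1 *: (piola_kirchhoff W F *m F^T).

Definition P1 (R : realType) (w : 'cV[R]_3) : 'M[R]_3 := w *m w^T.

Definition P2 (R : realType) (w : 'cV[R]_3) : 'M[R]_3 := 1%:M - w *m w^T.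

Definition shear (R : realType) (l1 l2 : R) (w : 'cV[R]_3) : 'M[R]_3 :=
  l1 *: P1 w + l2 *: P2 w.

(* T is multiplication by t1 on span{w} and by t2 on its orthogonal
   complement; t1 = t2 is allowed.  For w != 0 this determines t1 and t2. *)
Definition axial_eigenvalues (R : realType) (T : 'M[R]_3) (w : 'cV[R]_3)
    (t1 t2 : R) : Prop :=
  T *m w = t1 *: w /\
  forall v : 'cV[R]_3, w^T *m v = 0 -> T *m v = t2 *: v.

(* Main.v *)
Require Import Defs.
From HB Require Import structures.
From mathcomp Require Import all_boot all_order all_algebra.
From mathcomp Require Import all_classical all_reals all_analysis.
From mathcomp Require Import ring perm.

Import Order.TTheory GRing.Theory Num.Theory.
Import numFieldNormedType.Exports.

Local Open Scope classical_set_scope.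
Local Open Scope ring_scope.

(** Write [F] for [shear l1 l2 w], [S] for the Piola-Kirchhoff stress at [F],
    [p = h / 3], [J = l1 * l2 ^+ 2] and [u = l1 / l2].

    The eigenstructure of the stress comes from symmetry alone.  If a rotation
    [U] commutes with [F], then objectivity and isotropy give
    [W (U *m G *m U^T) = W G] for all [G] near [F], and differentiating at [F]
    shows that [U] commutes with [S] ([piola_comm]).  The half-turns about [w]
    and about every vector orthogonal to [w] commute with [F], and commuting
    with the half-turn about [a] amounts to commuting with [a *m a^T].  Hence
    [w] and all vectors orthogonal to [w] are eigenvectors of [S], and
    polarizing [a *m a^T] shows that the latter share one eigenvalue
    ([scalar_on_perp]).  Taking traces of [S *m P1 w] and [S *m P2 w]
    identifies the two eigenvalues with the derivative of [W] in the direction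
    [P1 w] and half its derivative in the direction [P2 w] ([piola_eigen]).
    These are [d1 L] and [d2 L / 2] for
    [L (l1, l2) = J `^ p * f (l1 / l2)], so they do not depend on [w]; the
    Cauchy stress multiplies them by [l1 / J] and [l2 / J].

    Computing the derivatives of [L], the terms in [f u] cancel in the
    difference of the Cauchy stresses, which leaves
    [t1 - t2 = 3 / 2 * J `^ p / J * (u * f' u)].
    As [f'] is nondecreasing and vanishes at [1], [f' u] has the sign of
    [u - 1], which is that of [l1 - l2] ([sg_derive1_convex]).  The derivatives
    of [f] exist because [f] is the restriction of [W] to the line of the
    matrices [shear u 1 w], divided by a power of [u] ([profile_derivable2]). *)

(** * Dyads and half-turns *)

Lemma mulmx_inner {R : comPzRingType} (m n p : nat) (A : 'M[R]_(m, 1))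
    (a b : 'cV[R]_n) (B : 'M[R]_(1, p)) :
  (A *m a^T) *m (b *m B) = (a^T *m b) 0 0 *: (A *m B).
Proof.
by rewrite mulmxA -(mulmxA A) {1}[a^T *m b]mx11_scalar mul_mx_scalar -scalemxAl.
Qed.

Lemma inner_sum {R : pzRingType} (n : nat) (a b : 'cV[R]_n) :
  (a^T *m b) 0 0 = \sum_(i < n) a i 0 * b i 0.
Proof. by rewrite !mxE; apply: eq_bigr => i _; rewrite mxE. Qed.

Lemma inner_neq0 {R : realDomainType} (n : nat) (a : 'cV[R]_n) :
  a != 0 -> (a^T *m a) 0 0 != 0.
Proof.
apply: contra_neq; rewrite inner_sum => /psumr_eq0P a0.
apply/matrixP => i j; rewrite ord1 mxE; apply/eqP.
by rewrite -sqrf_eq0 expr2 a0// => k _; rewrite -expr2 sqr_ge0.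
Qed.

(** The matrix is [x] times the identity on the orthogonal complement of [a] and
    sends [a] to [(x + y * |a|^2) *: a].  The determinant is expanded in
    coordinates, which also covers [a = 0] and any commutative ring. *)
Lemma det_scalar_rank1 {R : comPzRingType} (x y : R) (a : 'cV[R]_3) :
  \det (x%:M + y *: (a *m a^T)) = x ^+ 2 * (x + y * (a^T *m a) 0 0).
Proof.
(* Entries indexed by nat let the nested lifts of the expansion compute. *)
have [v ->] : exists v : nat -> R, a = \col_i v i.
  exists (fun k => a (inord k) 0); apply/colP => i.
  by rewrite mxE inord_val.
rewrite inner_sum !big_ord_recl big_ord0.
rewrite (expand_det_row _ ord0) !big_ord_recl big_ord0 /cofactor.
rewrite !(expand_det_row _ ord0) !big_ord_recl !big_ord0 /cofactor !det_mx11.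
rewrite !mxE !big_ord_recl !big_ord0 !mxE /= /bump /=.
ring.
Qed.

Lemma dyad_comm {R : comPzRingType} (n : nat) (c : R) (a : 'cV[R]_n)
    (F : 'M[R]_n) :
  F^T = F -> F *m a = c *: a -> (a *m a^T) *m F = F *m (a *m a^T).
Proof.
move=> FT Fa; rewrite mulmxA Fa -mulmxA -[F in LHS]FT -trmx_mul Fa.
by rewrite linearZ/= -scalemxAl -scalemxAr.
Qed.

Lemma dyad_mul {R : comPzRingType} (n : nat) (a b c : 'cV[R]_n) :
  a *m b^T *m c = (b^T *m c) 0 0 *: a.
Proof. by rewrite -[c in LHS]mulmx1 mulmx_inner mulmx1. Qed.

(** For [a != 0], [S] commutes with [a *m a^T] exactly when [a] is an
    eigenvector of [S] and of its transpose.  Nonzero vectors [a] and [b] get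
    the same eigenvalue because the hypothesis, being quadratic in [a],
    polarizes to [a *m b^T + b *m a^T], which is then applied to [b]. *)
Lemma scalar_on_perp {R : realFieldType} (n : nat) (w : 'cV[R]_n)
    (S : 'M[R]_n) :
  (forall a : 'cV[R]_n, w^T *m a = 0 -> (a *m a^T) *m S = S *m (a *m a^T)) ->
  exists c, forall v : 'cV[R]_n, w^T *m v = 0 -> S *m v = c *: v.
Proof.
move=> comm.
have [[b [wb b0]]|nob] := pselect (exists b : 'cV[R]_n, w^T *m b = 0 /\ b != 0);
  last first.
  exists 0 => v wv; have [->|v0] := eqVneq v 0; first by rewrite mulmx0 scaler0.
  by exfalso; apply: nob; exists v.
have bb0 := inner_neq0 _ b b0; set bb := (b^T *m b) 0 0 in bb0.
pose c := (b^T *m (S *m b)) 0 0 / bb.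
have Sb : S *m b = c *: b.
  have /(congr1 (mulmx^~ b)) := comm b wb.
  rewrite -(mulmxA _ S) -(mulmxA S) !dyad_mul -scalemxAr -/bb => E.
  by rewrite /c mulrC -scalerA E scalerA mulVf// scale1r.
exists c => a wa.
have polar : (a *m b^T + b *m a^T) *m S = S *m (a *m b^T + b *m a^T).
  have wab : w^T *m (a + b) = 0 by rewrite mulmxDr wa wb addr0.
  have -> : a *m b^T + b *m a^T =
      (a + b) *m (a + b)^T - a *m a^T - b *m b^T.
    rewrite linearD/= mulmxDl !mulmxDr.
    rewrite -[RHS]addrA -opprD [b *m a^T + b *m _]addrC.
    by rewrite addrACA addrAC subrr add0r.
  by rewrite !mulmxBl !mulmxBr !comm.
have := congr1 (mulmx^~ b) polar.
rewrite mulmxDl mulmxDr !mulmxDl -!(mulmxA _ S) -!(mulmxA S) !dyad_mul.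
rewrite Sb -!scalemxAr [(c *: (b^T *m b)) 0 0]mxE [(c *: (a^T *m b)) 0 0]mxE.
rewrite Sb -/bb !scalerA [c * bb]mulrC [c * _]mulrC => /addIr.
by rewrite -scalerA => /(scalerI bb0).
Qed.

(** The rotation by the angle pi about the axis spanned by [a], for
    [a != 0]. *)
Definition half_turn {R : realType} (a : 'cV[R]_3) : 'M[R]_3 :=
  (- 1)%:M + (2 / (a^T *m a) 0 0) *: (a *m a^T).

Lemma tr_half_turn {R : realType} (a : 'cV[R]_3) :
  (half_turn a)^T = half_turn a.
Proof.
by rewrite /half_turn linearD linearZ /= tr_scalar_mx trmx_mul trmxK.
Qed.

Lemma half_turnK {R : realType} (a : 'cV[R]_3) :
  a != 0 -> half_turn a *m half_turn a = 1%:M.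
Proof.
move=> /inner_neq0; rewrite /half_turn; set q := (a^T *m a) 0 0 => q0.
rewrite mulmxDl !mulmxDr -scalar_mxM mulrNN mul1r mul_scalar_mx mul_mx_scalar.
rewrite -scalemxAl -scalemxAr mulmx_inner -/q !scalerA -addrA -!scalerDl.
rewrite (_ : _ + _ = 0 :> R) ?scale0r ?addr0//.
by field.
Qed.

Lemma half_turn_SO3 {R : realType} (a : 'cV[R]_3) :
  a != 0 -> SO3 (half_turn a).
Proof.
move=> a0; split; first by rewrite tr_half_turn half_turnK.
by rewrite det_scalar_rank1 mulfVK ?inner_neq0//; ring.
Qed.

Lemma half_turn_comm {R : realType} (a : 'cV[R]_3) (F : 'M[R]_3) : a != 0 ->
  half_turn a *m F = F *m half_turn a <->
  (a *m a^T) *m F = F *m (a *m a^T).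
Proof.
move=> a0; have k0 : 2 / (a^T *m a) 0 0 != 0.
  by rewrite mulf_neq0 ?invr_neq0 ?inner_neq0 ?pnatr_eq0.
rewrite /half_turn mulmxDl mulmxDr scalar_mxC -scalemxAl -scalemxAr.
split => [/addrI /(scalerI k0)//|->//].
Qed.

(** * Directional derivatives and the Piola-Kirchhoff stress *)

Lemma det_continuous {R : realType} (n : nat) :
  continuous (fun A : 'M[R]_n => \det A).
Proof.
rewrite /determinant; apply: continuous_big => [|s _ A].
  exact: add_continuous.
apply: (@continuousM R _ (fun=> (-1) ^+ s)); first exact: cst_continuous.
apply: continuous_big => [|i _ B]; first exact: mul_continuous.
exact: coord_continuous.
Qed.

Lemma nbhs_GLplus3 {R : realType} (F : 'M[R]_3) :
  GLplus3 F -> \forall G \near F, GLplus3 G.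
Proof.
move=> F0; have cdet : \det G @[G --> F] --> \det F by exact: det_continuous.
exact: (cvgr_gt _ cdet _ F0).
Qed.

Lemma mxtrace_delta {R : comPzRingType} (m n : nat) (A : 'M[R]_(m, n)) i j :
  \tr (delta_mx i j *m A) = A j i.
Proof.
rewrite -(mul_delta_mx (0 : 'I_1)) -mulmxA -rowE mxtrace_mulC -colE.
by rewrite /mxtrace big_ord1 !mxE.
Qed.

(** [S] represents the differential of [W] for the trace pairing. *)
Lemma derive_piola {R : realType} (W : 'M[R]_3 -> R) (F H : 'M[R]_3) :
  differentiable W F -> 'D_H W F = \tr (H *m (piola_kirchhoff W F)^T).
Proof.
move=> dW; rewrite deriveE// [in LHS](matrix_sum_delta H) linear_sum.
apply: eq_bigr => i _; rewrite linear_sum mxE; apply: eq_bigr => j _.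
by rewrite linearZ/= !mxE deriveE.
Qed.

(** The map [G |-> U *m G *m U^T] leaves [W] invariant near [F] and fixes [F],
    so the derivative of [W] at [F] takes the same value in the directions [H]
    and [U *m H *m U^T].  Since [H] is arbitrary and the derivative is the trace
    pairing with [S], this gives [S = U^T *m S *m U]. *)
Lemma piola_comm {R : realType} (W : 'M[R]_3 -> R) (F U : 'M[R]_3) :
  objective W -> isotropic W -> GLplus3 F -> differentiable W F -> SO3 U ->
  U *m F = F *m U ->
  U *m piola_kirchhoff W F = piola_kirchhoff W F *m U.
Proof.
move=> Wo Wi F0 dW [UU dU] UF.
have UU' : U^T *m U = 1%:M by exact: mulmx1C.
have SUT : SO3 U^T by split; rewrite ?trmxK ?det_tr.
have WU : \forall G \near F, W G = W (U *m G *m U^T).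
  move: (nbhs_GLplus3 F F0); apply: filterS => G G0.
  by rewrite Wi// ?Wo// /GLplus3/= det_mulmx dU mul1r.
have DU H : 'D_H W F = 'D_(U *m H *m U^T) W F.
  have UFU : U *m F *m U^T = F by rewrite UF -mulmxA UU mulmx1.
  rewrite (near_eq_derive _ WU) /derive /=.
  under eq_fun do rewrite mulmxDr mulmxDl -scalemxAr -scalemxAl.
  by rewrite UFU.
have {DU} trU H : \tr (H *m (piola_kirchhoff W F)^T) =
   \tr (H *m (U^T *m (piola_kirchhoff W F)^T *m U)).
  rewrite -derive_piola// DU derive_piola//.
  by rewrite -!mulmxA mxtrace_mulC !mulmxA.
have SU : piola_kirchhoff W F = U^T *m piola_kirchhoff W F *m U.
  apply/matrixP => i j; rewrite [LHS]mxE derive_piola// trU.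
  rewrite mxtrace_delta (_ : _ *m U = (U^T *m piola_kirchhoff W F *m U)^T).
    by rewrite mxE.
  by rewrite !trmx_mul trmxK mulmxA.
by rewrite {1}SU !mulmxA UU mul1mx.
Qed.

(** Reads the eigenvalue [s] of [S] on the range of a projector [P] off a
    directional derivative of [W]. *)
Lemma derive_eigen {R : realType} (W : 'M[R]_3 -> R) (F P : 'M[R]_3) (s : R) :
  differentiable W F -> P^T = P -> piola_kirchhoff W F *m P = s *: P ->
  'D_P W F = s * \tr P.
Proof.
move=> dW PT SP; rewrite derive_piola// -mxtrace_tr trmx_mul trmxK PT SP.
exact: mxtraceZ.
Qed.

(** * Axially symmetric deformation gradients *)

Lemma shearE {R : realType} (l1 l2 : R) (w : 'cV[R]_3) :
  shear l1 l2 w = l2%:M + (l1 - l2) *: (w *m w^T).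
Proof.
by rewrite /shear /P1 /P2 scalerBr scalerBl scalemx1 addrCA addrA.
Qed.

Lemma tr_shear {R : realType} (l1 l2 : R) (w : 'cV[R]_3) :
  (shear l1 l2 w)^T = shear l1 l2 w.
Proof. by rewrite shearE linearD linearZ /= tr_scalar_mx trmx_mul trmxK. Qed.

Lemma inner_sphere2 {R : realType} (w : 'cV[R]_3) :
  sphere2 w -> w^T *m w = 1%:M.
Proof.
move=> w1; rewrite [LHS]mx11_scalar inner_sum; congr (_%:M).
by rewrite -[RHS]w1; apply: eq_bigr => i _; rewrite expr2.
Qed.

Lemma det_shear {R : realType} (l1 l2 : R) (w : 'cV[R]_3) : sphere2 w ->
  \det (shear l1 l2 w) = l1 * l2 ^+ 2.
Proof.
by move=> /inner_sphere2 w1; rewrite shearE det_scalar_rank1 w1 mxE /=; ring.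
Qed.

Lemma shear_axis {R : realType} (l1 l2 : R) (w : 'cV[R]_3) : sphere2 w ->
  shear l1 l2 w *m w = l1 *: w.
Proof.
move=> /inner_sphere2 w1; rewrite shearE mulmxDl mul_scalar_mx -scalemxAl.
by rewrite -mulmxA w1 mulmx1 -scalerDl addrC subrK.
Qed.

Lemma shear_perp {R : realType} (l1 l2 : R) (w v : 'cV[R]_3) : w^T *m v = 0 ->
  shear l1 l2 w *m v = l2 *: v.
Proof.
move=> wv; rewrite shearE mulmxDl mul_scalar_mx -scalemxAl.
by rewrite -mulmxA wv mulmx0 scaler0 addr0.
Qed.

Lemma piola_dyad_comm {R : realType} (W : 'M[R]_3 -> R) (l1 l2 : R)
    (w a : 'cV[R]_3) :
  objective W -> isotropic W -> differentiable W (shear l1 l2 w) ->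
  0 < l1 -> 0 < l2 -> sphere2 w -> a = w \/ w^T *m a = 0 ->
  (a *m a^T) *m piola_kirchhoff W (shear l1 l2 w) =
  piola_kirchhoff W (shear l1 l2 w) *m (a *m a^T).
Proof.
move=> Wo Wi dW l1_gt0 l2_gt0 w1 aw.
have [->|a0] := eqVneq a 0; first by rewrite mul0mx mul0mx mulmx0.
apply/half_turn_comm => //; apply: piola_comm => //.
- by rewrite /GLplus3/= det_shear// mulr_gt0// exprn_gt0.
- exact: half_turn_SO3.
- apply/half_turn_comm => //.
  case: aw => [->|wa].
    by apply: dyad_comm (tr_shear _ _ _) (shear_axis _ _ _ w1).
  by apply: dyad_comm (tr_shear _ _ _) (shear_perp _ _ _ _ wa).
Qed.

Lemma mulmx_P1 {R : realType} (w : 'cV[R]_3) (S : 'M[R]_3) (s : R) :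
  S *m w = s *: w -> S *m P1 w = s *: P1 w.
Proof. by move=> Sw; rewrite /P1 mulmxA Sw -scalemxAl. Qed.

Lemma mulmx_P2 {R : realType} (w : 'cV[R]_3) (S : 'M[R]_3) (s : R) :
  sphere2 w -> (forall v : 'cV[R]_3, w^T *m v = 0 -> S *m v = s *: v) ->
  S *m P2 w = s *: P2 w.
Proof.
move=> /inner_sphere2 w1 Sv; apply/matrixP => i j.
have wP : w^T *m col j (P2 w) = 0.
  by rewrite colE mulmxA /P2 mulmxBr mulmx1 mulmxA w1 mul1mx subrr mul0mx.
have /matrixP/(_ i 0) := Sv _ wP.
rewrite colE mulmxA -colE [LHS]mxE => ->.
by rewrite -colE !mxE.
Qed.

Lemma mxtrace_P1 {R : realType} (w : 'cV[R]_3) : sphere2 w -> \tr (P1 w) = 1.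
Proof. by move=> w1; rewrite mxtrace_mulC inner_sphere2// mxtrace1. Qed.

(** The factor [1 / 2] is the reciprocal of [\tr (P2 w)], the multiplicity of
    the second eigenvalue. *)
Lemma piola_eigen {R : realType} (W : 'M[R]_3 -> R) (l1 l2 : R) (w : 'cV[R]_3) :
  objective W -> isotropic W -> differentiable W (shear l1 l2 w) ->
  0 < l1 -> 0 < l2 -> sphere2 w ->
  axial_eigenvalues (piola_kirchhoff W (shear l1 l2 w)) w
    ('D_(P1 w) W (shear l1 l2 w)) ('D_(P2 w) W (shear l1 l2 w) / 2).
Proof.
move=> Wo Wi dW l10 l20 w1; set S := piola_kirchhoff _ _.
have comm a : a = w \/ w^T *m a = 0 -> (a *m a^T) *m S = S *m (a *m a^T).
  exact: piola_dyad_comm.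
have Sw : S *m w = (w^T *m (S *m w)) 0 0 *: w.
  have := congr1 (mulmx^~ w) (comm w (or_introl erefl)).
  rewrite -(mulmxA _ S) -(mulmxA S) !dyad_mul inner_sphere2//.
  by rewrite [1%:M _ _]mxE/= scale1r => ->.
have [s Sv] := scalar_on_perp _ w S (fun a wa => comm a (or_intror wa)).
split.
  rewrite (derive_eigen _ _ (P1 w) _ dW _ (mulmx_P1 _ _ _ Sw)).
    by rewrite mxtrace_P1// mulr1.
  by rewrite /P1 trmx_mul trmxK.
move=> v wv; rewrite (derive_eigen _ _ (P2 w) _ dW _ (mulmx_P2 _ _ _ w1 Sv)).
  by rewrite Sv// /P2 linearB/= mxtrace1 mxtrace_P1//; congr (_ *: _); field.
by rewrite /P2 linearB/= trmx1 trmx_mul trmxK.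
Qed.

Lemma cauchy_eigen {R : realType} (W : 'M[R]_3 -> R) (l1 l2 s1 s2 : R)
    (w : 'cV[R]_3) : sphere2 w ->
  axial_eigenvalues (piola_kirchhoff W (shear l1 l2 w)) w s1 s2 ->
  axial_eigenvalues (cauchy_stress W (shear l1 l2 w)) w
    ((l1 * l2 ^+ 2)^-1 * (l1 * s1)) ((l1 * l2 ^+ 2)^-1 * (l2 * s2)).
Proof.
move=> w1 [Sw Sv]; rewrite /cauchy_stress det_shear// tr_shear.
split => [|v wv].
  by rewrite -scalemxAl -mulmxA shear_axis// -scalemxAr Sw !scalerA -mulrA.
rewrite -scalemxAl -mulmxA (shear_perp _ _ w)// -scalemxAr Sv//.
by rewrite !scalerA -mulrA.
Qed.

(** * The energy as a function of the principal stretches *)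

Lemma is_derive_line {R : realType} (V : normedModType R) (W : V -> R)
    (A B : V) (x : R) : differentiable W (A + x *: B) ->
  is_derive x 1 (fun t => W (A + t *: B)) ('D_B W (A + x *: B)).
Proof.
move=> /diff_derivable dW.
have E : (fun h : R => h^-1 *:
     (((fun t => W (A + t *: B)) \o shift x) (h *: 1) - W (A + x *: B))) =
   (fun h => h^-1 *: ((W \o shift (A + x *: B)) (h *: B) - W (A + x *: B))).
  by apply/funext => h /=; rewrite -[h *: 1]/(h * 1) mulr1 scalerDl addrCA.
split; first by rewrite /derivable E; exact: dW.
by rewrite /derive E.
Qed.

Lemma is_derive_shear1 {R : realType} (W : 'M[R]_3 -> R) (l1 l2 : R)
    (w : 'cV[R]_3) : differentiable W (shear l1 l2 w) ->
  is_derive l1 1 (fun x => W (shear x l2 w)) ('D_(P1 w) W (shear l1 l2 w)).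
Proof.
rewrite /shear; under eq_fun do rewrite addrC; rewrite addrC.
exact: is_derive_line.
Qed.

Lemma is_derive_shear2 {R : realType} (W : 'M[R]_3 -> R) (l1 l2 : R)
    (w : 'cV[R]_3) : differentiable W (shear l1 l2 w) ->
  is_derive l2 1 (fun x => W (shear l1 x w)) ('D_(P2 w) W (shear l1 l2 w)).
Proof. exact: is_derive_line. Qed.

(** Twice differentiability passes from [g] to its product with a power; it is
    stated for [f] agreeing with this product only on the positive axis. *)
Lemma derivable_mul_powR {R : realType} (f g dg : R -> R) (q : R) :
  (forall u : R, 0 < u -> is_derive u 1 g (dg u)) ->
  (forall u : R, 0 < u -> derivable dg u 1) ->
  (forall u : R, 0 < u -> f u = g u * u `^ q) ->
  forall u : R, 0 < u -> derivable f u 1 /\ derivable (f^`())%classic u 1.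
Proof.
move=> g' dg' fE.
have dpow (r u : R) : 0 < u -> derivable (fun x : R => x `^ r) u 1.
  by move=> u0; have /@ex_derive := @is_derive1_powR R r u u0.
have f' (u : R) : 0 < u ->
    is_derive u 1 f (g u * (q * u `^ (q - 1)) + dg u * u `^ q).
  move=> u0; have gM := is_deriveM (g' u u0) (is_derive1_powR q u0).
  apply: (@near_eq_is_derive _ _ _ (g * (fun x => x `^ q))).
    by move: (lt_nbhsr u0); apply: filterS => x x0; rewrite fE.
  by apply: is_derive_eq; rewrite /GRing.scale/= [X in _ + X]mulrC.
move=> u u0; split; first by have /@ex_derive := f' u u0.
apply: (@near_eq_derivable _ _ _
  (g * (fun x => q * x `^ (q - 1)) + dg * (fun x => x `^ q))).
- move: (lt_nbhsr u0); apply: filterS => x x0.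
  by rewrite derive1E (@derive_val _ _ _ _ _ _ _ (f' x x0)).
- apply: derivableD; apply: derivableM.
  + by have /@ex_derive := g' u u0.
  + by apply: (@derivableM _ _ (fun=> q)) => //; exact: dpow.
  + exact: dg'.
  + exact: dpow.
Qed.

(** The derivative is nondecreasing and vanishes at [a], so it has the sign of
    [u - a]. *)
Lemma sg_derive1_convex {R : realType} (f : R -> R) (a : R) :
  0 < a ->
  (forall u : R, 0 < u -> derivable (f^`())%classic u 1) ->
  (forall u : R, 0 < u -> 0 <= (f^`(2))%classic u) -> (f^`())%classic a = 0 ->
  forall u : R, 0 < u -> 0 <= (f^`())%classic u * (u - a).
Proof.
move=> a0 df' f''0 f'a.
have incr (x y : R) : 0 < x -> x <= y -> (f^`())%classic x <= (f^`())%classic y.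
  move=> x0 xy.
  have pos (z : R) : z \in `[x, y] -> 0 < z.
    by rewrite in_itv => /andP[+ _]; exact: lt_le_trans.
  apply: (@ger0_derive1_le_cc R _ x y) => //.
  - by move=> z /subset_itv_oo_cc /pos; exact: df'.
  - by move=> z /subset_itv_oo_cc /pos; exact: f''0.
  - by apply: derivable_within_continuous => z /pos; exact: df'.
  - by rewrite in_itv/= lexx.
  - by rewrite in_itv/= lexx andbT.
move=> u u0; have [au|ua] := leP a u.
  by rewrite mulr_ge0 ?subr_ge0// -f'a incr.
by rewrite mulr_le0 ?subr_le0 ?(ltW ua)// -f'a incr// ltW.
Qed.

Lemma is_derive_powR_mul_comp {R : realType} (f J U : R -> R) (p x dJ dU : R) :
  0 < J x -> is_derive x 1 J dJ -> is_derive x 1 U dU -> derivable f (U x) 1 ->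
  is_derive x 1 (fun y => J y `^ p * f (U y))
    (J x `^ p * (p * dJ / J x * f (U x) + dU * (f^`())%classic (U x))).
Proof.
move=> J0 hJ hU /derivableP f'; rewrite -derive1E in f'.
have hM := is_deriveM
  (@is_derive1_comp _ (fun y => y `^ p) J _ _ _ (is_derive1_powR p J0) hJ)
  (@is_derive1_comp _ f U _ _ _ f' hU).
apply: is_derive_eq.
rewrite /GRing.scale/= powRB ?(gt_eqF J0) ?implybT// powRr1 ?ltW//.
by field; rewrite gt_eqF.
Qed.

(** The factor [J `^ p / l1] is pulled out so that, after multiplication by
    [l1], the term in [f] is [p * J `^ p * f u]; the same term appears in
    [l2 / 2] times the derivative in [l2], and the two cancel. *)
Lemma is_derive_energy1 {R : realType} (f : R -> R) (p l1 l2 : R) :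
  0 < l1 -> 0 < l2 -> derivable f (l1 / l2) 1 ->
  is_derive l1 1 (fun x => (x * l2 ^+ 2) `^ p * f (x / l2))
    ((l1 * l2 ^+ 2) `^ p / l1 *
     (p * f (l1 / l2) + l1 / l2 * (f^`())%classic (l1 / l2))).
Proof.
move=> l10 l20 f'.
have J0 : 0 < l1 * l2 ^+ 2 by rewrite mulr_gt0 ?exprn_gt0.
have lin c : is_derive l1 1 (fun x : R => x * c) c.
  have := is_deriveM (is_derive_id l1 1) (is_derive_cst c l1 1).
  by rewrite scaler0 add0r => h; apply: is_derive_eq; exact: mulr1.
have := is_derive_powR_mul_comp f (fun x => x * l2 ^+ 2) (fun x => x / l2) p l1
  _ _ J0 (lin _) (lin _) f'.
move=> h; apply: is_derive_eq => /=.
by field; rewrite !gt_eqF.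
Qed.

Lemma is_derive_energy2 {R : realType} (f : R -> R) (p l1 l2 : R) :
  0 < l1 -> 0 < l2 -> derivable f (l1 / l2) 1 ->
  is_derive l2 1 (fun x => (l1 * x ^+ 2) `^ p * f (l1 / x))
    ((l1 * l2 ^+ 2) `^ p / l2 *
     (2 * p * f (l1 / l2) - l1 / l2 * (f^`())%classic (l1 / l2))).
Proof.
move=> l10 l20 f'.
have J0 : 0 < l1 * l2 ^+ 2 by rewrite mulr_gt0 ?exprn_gt0.
have l2n0 : l2 != 0 by rewrite gt_eqF.
have hJ : is_derive l2 1 (fun x : R => l1 * x ^+ 2) (2 * l1 * l2).
  have := is_deriveM (is_derive_cst l1 l2 1)
    (is_deriveM (is_derive_id l2 1) (is_derive_id l2 1)).
  move=> h; apply: is_derive_eq => /=; rewrite /GRing.scale/=; ring.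
have hU : is_derive l2 1 (fun x : R => l1 / x) (- l1 / l2 ^+ 2).
  have := is_deriveM (is_derive_cst l1 l2 1)
    (@is_deriveV _ id _ _ _ l2n0 (is_derive_id l2 1)).
  by move=> h; apply: is_derive_eq => /=; rewrite /GRing.scale/=; field.
have := is_derive_powR_mul_comp f (fun x => l1 * x ^+ 2) (fun x => l1 / x) p l2
  _ _ J0 hJ hU f'.
move=> h; apply: is_derive_eq => /=.
by field; rewrite !gt_eqF.
Qed.

(** On the line of the matrices [shear u 1 w] the representation of [W] can be
    solved for [f]: [f u = W (shear u 1 w) * u `^ (- p)].  Any unit vector [w]
    serves. *)
Lemma profile_derivable2 {R : realType} (W : 'M[R]_3 -> R) (f : R -> R) (p : R) :
  C2_on (@GLplus3 R) W ->
  (forall (l1 l2 : R) (w : 'cV[R]_3), 0 < l1 -> 0 < l2 -> sphere2 w ->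
     W (shear l1 l2 w) = (l1 * l2 ^+ 2) `^ p * f (l1 / l2)) ->
  forall u : R, 0 < u -> derivable f u 1 /\ derivable (f^`())%classic u 1.
Proof.
move=> [W1 W2] Wf.
pose w : 'cV[R]_3 := delta_mx 0 0.
have w1 : sphere2 w.
  by rewrite /sphere2/= !big_ord_recl big_ord0 !mxE/= expr1n expr0n/= !addr0.
have GL (u : R) : 0 < u -> GLplus3 (shear u 1 w).
  by move=> u0; rewrite /GLplus3/= det_shear// expr1n mulr1.
apply: (derivable_mul_powR _ (fun u => W (shear u 1 w))
  (fun u => 'D_(P1 w) W (shear u 1 w)) (- p)) => u u0.
- exact/is_derive_shear1/(W1 _ (GL u u0)).1.
- have := is_derive_shear1 _ u 1 w (W2 (P1 w) _ (GL u u0)).1.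
  by move/(@ex_derive _ _ _ _ _ _ _).
- rewrite Wf// expr1n mulr1 divr1 powRN mulrAC mulfV ?mul1r//.
  by rewrite gt_eqF// powR_gt0.
Qed.

(** * The Baker-Ericksen condition *)

Theorem proposition11p2 (R : realType) (h : R) (W : 'M[R]_3 -> R) (f : R -> R)
  (W_ge0 : forall F : 'M[R]_3, GLplus3 F -> 0 <= W F)
  (W_C2 : C2_on (@GLplus3 R) W)
  (W_obj : objective W)
  (W_iso : isotropic W)
  (W_hom : homogeneous_of_degree h W)
  (W_shear : forall (l1 l2 : R) (w : 'cV[R]_3),
     0 < l1 -> 0 < l2 -> sphere2 w ->
     W (shear l1 l2 w) = (l1 * l2 ^+ 2) `^ (h / 3) * f (l1 / l2))
  (f'1 : (f^`())%classic 1 = 0)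
  (f''_ge0 : forall u : R, 0 < u -> 0 <= (f^`(2))%classic u) :
  exists t1 t2 : R -> R -> R,
    (forall (l1 l2 : R) (w : 'cV[R]_3), 0 < l1 -> 0 < l2 -> sphere2 w ->
       axial_eigenvalues (cauchy_stress W (shear l1 l2 w)) w
         (t1 l1 l2) (t2 l1 l2)) /\
    (forall l1 l2 : R, 0 < l1 -> 0 < l2 -> l1 != l2 ->
       0 <= (t1 l1 l2 - t2 l1 l2) / (l1 - l2)).
Proof.
have fC2 := profile_derivable2 W f (h / 3) W_C2 W_shear.
have f'_sg := sg_derive1_convex f 1 ltr01
  (fun u u0 => (fC2 u u0).2) f''_ge0 f'1.
pose p := h / 3; pose J (l1 l2 : R) := l1 * l2 ^+ 2.
(* The derivative of L in l1 and half its derivative in l2. *)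
pose s1 (l1 l2 : R) := J l1 l2 `^ p / l1 *
  (p * f (l1 / l2) + l1 / l2 * (f^`())%classic (l1 / l2)).
pose s2 (l1 l2 : R) := J l1 l2 `^ p / l2 *
  (2 * p * f (l1 / l2) - l1 / l2 * (f^`())%classic (l1 / l2)) / 2.
exists (fun l1 l2 => (J l1 l2)^-1 * (l1 * s1 l1 l2)).
exists (fun l1 l2 => (J l1 l2)^-1 * (l2 * s2 l1 l2)).
split=> [l1 l2 w l10 l20 w1|l1 l2 l10 l20 l12].
  have dW : differentiable W (shear l1 l2 w).
    apply: (W_C2.1 _ _).1; rewrite /GLplus3/= det_shear//.
    by rewrite mulr_gt0// exprn_gt0.
  have f' := (fC2 _ (divr_gt0 l10 l20)).1.
  have D1 : 'D_(P1 w) W (shear l1 l2 w) = s1 l1 l2.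
    rewrite -(@derive_val _ _ _ _ _ _ _ (is_derive_shear1 _ _ _ _ dW)).
    rewrite -[RHS](@derive_val _ _ _ _ _ _ _
      (is_derive_energy1 f p _ _ l10 l20 f')).
    apply: near_eq_derive; move: (lt_nbhsr l10).
    by apply: filterS => x x0; rewrite W_shear.
  have D2 : 'D_(P2 w) W (shear l1 l2 w) / 2 = s2 l1 l2.
    congr (_ / 2).
    rewrite -(@derive_val _ _ _ _ _ _ _ (is_derive_shear2 _ _ _ _ dW)).
    rewrite -[RHS](@derive_val _ _ _ _ _ _ _
      (is_derive_energy2 f p _ _ l10 l20 f')).
    apply: near_eq_derive; move: (lt_nbhsr l20).
    by apply: filterS => x x0; rewrite W_shear.
  by apply: cauchy_eigen => //; rewrite -D1 -D2; exact: piola_eigen.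
have J0 : 0 < J l1 l2 by rewrite mulr_gt0 ?exprn_gt0.
set u := l1 / l2; have u0 : 0 < u by exact: divr_gt0.
(* Dividing by u - 1 amounts to multiplying by it, up to its positive square. *)
have -> : ((J l1 l2)^-1 * (l1 * s1 l1 l2) - (J l1 l2)^-1 * (l2 * s2 l1 l2)) /
    (l1 - l2) = 3 / 2 * (J l1 l2 `^ p / J l1 l2) * u / l2 / (u - 1) ^+ 2 *
    ((f^`())%classic u * (u - 1)).
  have l2n0 : l2 != 0 by rewrite gt_eqF.
  rewrite /s1 /s2 -/u (_ : l1 - l2 = l2 * (u - 1)); last by rewrite /u; field.
  have u1 : u - 1 != 0.
    rewrite subr_eq0; apply: contra_neq l12 => u1.
    by rewrite -[l1](divfK l2n0) -/u u1 mul1r.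
  by field; rewrite u1 !gt_eqF.
by rewrite mulr_ge0 ?f'_sg// !mulr_ge0 ?invr_ge0 ?sqr_ge0 ?powR_ge0// ltW.
Qed.
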